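(* Let $G=(V,E)$ be a strongly connected finite directed multigraph (parallel edges between the same ordered pair of vertices are allowed and are considered distinct). Then a deadlock-free routing for $G$ exists if and only if there is a vertex $v\in V$ and two edge-disjoint subsets $T_{\mathrm{in}},T_{\mathrm{out}}\subseteq E$ such that $T_{\mathrm{in}}$ forms a spanning directed tree directed into $v$ (every vertex has a directed path to $v$ using only edges of $T_{\mathrm{in}}$) and $T_{\mathrm{out}}$ forms a spanning directed tree directed away from $v$ (every vertex is reachable from $v$ by a directed path using only edges of $T_{\mathrm{out}}$).
   Context: A network is a strongly connected directed multigraph $G=(V,E)$ whose vertices are nodes and whose edges are communication channels. A routing for $G$ is a deterministic assignment, to each ordered pair $(a,b)$ of distinct vertices, of a directed path in $G$ from $a$ to $b$ (depending only on the source and the destination). Given a routing, there is a dependency from edge $e_1$ to edge $e_2$ if some routing path uses $e_2$ immediately after $e_1$. The dependency graph is the directed graph whose vertex set is $E$ and whose edges are these dependencies. A routing is deadlock-free if its dependency graph is acyclic (this is the Dally–Seitz characterization of deadlock freedom). No virtual channels may be added: the routing must use the edges of $G$ as given. No efficiency requirement (e.g. shortest paths) is imposed on the routing. *)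

(* Defs.v *)
From mathcomp Require Import all_boot.

Set Implicit Arguments.
Unset Strict Implicit.
Unset Printing Implicit Defensive.

Record multigraph := Multigraph {
  vertex : finType;
  edge : finType;
  src : edge -> vertex;
  tgt : edge -> vertex
}.

(* [A] is a type of arcs, oriented by [s] and [t]; it is instantiated below with
   the edges of a multigraph, and with its edges traversed in either direction. *)
Section Walks.
Variables (V : eqType) (A : Type) (s t : A -> V).

Fixpoint walk (a : V) (p : seq A) (b : V) : bool :=
  if p is e :: q then (s e == a) && walk (t e) q b else a == b.

Definition simple_path (a : V) (p : seq A) (b : V) : bool :=
  walk a p b && uniq (a :: map t p).

End Walks.

Section Routing.
Variable G : multigraph.
Notation V := (vertex G).
Notation E := (edge G).

Definition dipath (a : V) (p : seq E) (b : V) : bool :=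
  simple_path (@src G) (@tgt G) a p b.

(* A strongly connected graph has at least one vertex. *)
Definition strongly_connected : Prop :=
  0 < #|V| /\ forall a b : V, exists p, dipath a p b.

(* The values [r a a] are irrelevant: a routing is only constrained, and only
   creates dependencies, on pairs of distinct vertices. *)
Definition is_routing (r : V -> V -> seq E) : Prop :=
  forall a b : V, a != b -> dipath a (r a b) b.

Definition dependency (r : V -> V -> seq E) : rel E :=
  [rel e1 e2 | [exists a : V, exists b : V,
                  (a != b) && infix [:: e1; e2] (r a b)]].

Definition acyclic (T : Type) (e : rel T) : Prop :=
  forall c : seq T, cycle e c -> c = [::].

Definition deadlock_free (r : V -> V -> seq E) : Prop :=
  acyclic (dependency r).

(* Undirected traversals: [(e, true)] follows [e] from [src e] to [tgt e],
   [(e, false)] follows it backwards. *)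
Definition usrc (x : E * bool) : V := if x.2 then src x.1 else tgt x.1.
Definition utgt (x : E * bool) : V := if x.2 then tgt x.1 else src x.1.

Definition uconnected (T : {set E}) : Prop :=
  forall a b : V, exists p : seq (E * bool),
    simple_path usrc utgt a p b /\ {subset unzip1 p <= T}.

(* A cycle is a nonempty closed walk with distinct edges and distinct vertices;
   [map utgt c] lists the vertices of a closed walk [c], base point once.
   Loops and pairs of (anti)parallel edges are cycles. *)
Definition uacyclic (T : {set E}) : Prop :=
  forall (a : V) (c : seq (E * bool)),
    walk usrc utgt a c a -> {subset unzip1 c <= T} ->
    uniq (unzip1 c) -> uniq (map utgt c) -> c = [::].

Definition spanning_tree (T : {set E}) : Prop := uconnected T /\ uacyclic T.

Definition spanning_tree_into (v : V) (T : {set E}) : Prop :=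
  spanning_tree T /\
  forall u : V, exists p, dipath u p v /\ {subset p <= T}.

Definition spanning_tree_from (v : V) (T : {set E}) : Prop :=
  spanning_tree T /\
  forall u : V, exists p, dipath v p u /\ {subset p <= T}.

End Routing.

(* Main.v *)
Require Import Defs.
From mathcomp Require Import all_boot.

Set Implicit Arguments.
Unset Strict Implicit.
Unset Printing Implicit Defensive.

(** Both directions rest on ordering the edges.  Given the two trees, the route
    from [a] to [b] climbs [Tin] to the root and then descends [Tout], with loops
    cut out; edges only increase along it when [Tin] is ordered towards the root,
    [Tout] away from it, and [Tin] comes before [Tout].

    Conversely, let [D] be a smallest set of edges that is closed under
    predecessors for the dependency relation and in which some vertex [v] can be
    reached from everywhere.  No edge of [D] leaves [v]: otherwise follow
    dependencies inside [D] from such an edge to a maximal edge [g]; every vertex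
    still reaches the source of [g] without [g], so [D :\ g] contradicts
    minimality.  Hence every route from [v] starts, and therefore stays, outside
    [D], and the trees are found in [D] and in its complement. *)

(** * Walks *)

Lemma walk_cat (V : eqType) (A : Type) (s t : A -> V) a b p q :
  walk s t a (p ++ q) b <-> exists2 c, walk s t a p c & walk s t c q b.
Proof.
elim: p a => [|e p IHp] a /=.
  by split=> [wq|[c /eqP-> //]]; exists a.
split=> [/andP[-> /IHp[c wp wq]]|[c /andP[-> wp] wq]]; first by exists c.
by apply/IHp; exists c.
Qed.

Section WalkTheory.
Variables (V A : eqType) (s t : A -> V).

Lemma walk_rev a b p : walk s t a p b -> walk t s b (rev p) a.
Proof.
elim: p a => [|e p IHp] a /=; first by rewrite eq_sym.
case/andP=> /eqP <- /IHp wp; rewrite rev_cons -cats1.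
by apply/walk_cat; exists (t e) => //=; rewrite !eqxx.
Qed.

Lemma walk_map (A' : eqType) (s' t' : A' -> V) (f : A' -> A) a p b :
  s \o f =1 s' -> t \o f =1 t' -> walk s t a (map f p) b = walk s' t' a p b.
Proof. by move=> es et; elim: p a => //= e p IHp a; rewrite IHp -es -et. Qed.

Lemma simple_path_suffix a b c q :
  simple_path s t c q b -> a \in c :: map t q ->
  exists2 q', subseq q' q & simple_path s t a q' b.
Proof.
elim: q c => [|e q IHq] c sq.
  by rewrite mem_seq1 => /eqP->; exists [::].
rewrite in_cons => /orP[/eqP->|aq]; first by exists (e :: q).
have sq' : simple_path s t (t e) q b.
  by move: sq => /andP[/= /andP[_ wq] /andP[_ uq]]; rewrite /simple_path wq.
have [q' sub_q' sq''] := IHq _ sq' aq.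
by exists q' => //; apply: subseq_trans sub_q' (subseq_cons _ _).
Qed.

(** Loop erasure: when the start already lies on the simplified tail, only the part of the tail from
    that visit on is kept. Being a subsequence, the result inherits edge-set membership and
    sortedness for a transitive order. *)
Lemma walk_simple_path a b p :
  walk s t a p b -> exists2 q, subseq q p & simple_path s t a q b.
Proof.
elim: p a => [|e p IHp] a /=; first by exists [::]; rewrite // /simple_path /= andbT.
case/andP=> /eqP sea /IHp[q sub_q sq].
have [aq|aq] := boolP (a \in t e :: map t q).
  have [q' sub_q' sq'] := simple_path_suffix sq aq.
  by exists q' => //; apply: subseq_trans (subseq_trans sub_q' sub_q) (subseq_cons _ _).
exists (e :: q); first by rewrite /= eqxx.
by move: sq => /andP[wq uq]; rewrite /simple_path /= sea eqxx wq aq.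
Qed.

Lemma walk_sorted (Q : pred A) (lt : rel A) a b p :
  {in Q &, forall e1 e2, t e1 = s e2 -> lt e1 e2} ->
  walk s t a p b -> all Q p -> sorted lt p.
Proof.
move=> ltQ; elim: p a => //= e p IHp a /andP[_ wp] /andP[Qe Qp].
case: p IHp wp Qp => //= e' p IHp /andP[/eqP e_e' wp] /andP[Qe' Qp].
by rewrite ltQ //=; apply: (IHp (t e)); rewrite ?e_e' ?eqxx ?wp ?Qe'.
Qed.

Lemma walk_infix2 a b p e1 e2 :
  walk s t a p b -> infix [:: e1; e2] p -> t e1 = s e2.
Proof.
move=> wp /infixP[p1 [p2 def_p]].
move: wp; rewrite def_p => /walk_cat[c _] /=.
by case/andP=> _ /andP[/eqP].
Qed.

(** A potential for reaching [v] inside [D]: following decreasing edges can only get stuck at [v].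
    Exchanging [s] and [t] gives the version for leaving [v]. *)
Definition descends (D : pred A) (v : V) (h : V -> nat) :=
  forall x, x != v -> exists e, [/\ D e, s e = x & h (t e) < h x].

Lemma descends_walk D v h : descends D v h ->
  forall x, exists2 p, walk s t x p v & all [pred e | D e && (h (t e) < h (s e))] p.
Proof.
move=> dD x; have [n] := ubnP (h x); elim: n x => // n IHn x.
have [-> _|/dD[e [De <- hte]] hx] := eqVneq x v; first by exists [::]; rewrite /= ?eqxx.
have [p wp allp] := IHn (t e) (leq_trans hte hx).
by exists (e :: p); rewrite /= ?eqxx ?wp // De hte.
Qed.

End WalkTheory.

(** Take for [h] the length of a shortest walk to [v] in [D]; the first edge of such a walk
    decreases it. *)
Lemma walk_descends (V : eqType) (A : finType) (s t : A -> V) (D : pred A) (v : V) :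
  (forall x, exists2 p, walk s t x p v & all D p) ->
  exists h, descends s t D v h.
Proof.
move=> wD.
(* Tuples of a fixed length form a finite type, so [P] is boolean and a least length exists. *)
pose P x n := [exists p : n.-tuple A, walk s t x p v && all D p].
have exP x : exists n, P x n.
  have [p wp Dp] := wD x; exists (size p); apply/existsP.
  by exists (in_tuple p); rewrite wp.
have hle x p : walk s t x p v -> all D p -> ex_minn (exP x) <= size p.
  move=> wp Dp; case: ex_minnP => m _; apply; apply/existsP.
  by exists (in_tuple p); rewrite wp.
exists (fun x => ex_minn (exP x)) => x xv.
case: (ex_minnP (exP x)) => m /existsP[p /andP[]] wp Dp _.
have sz_p := size_tuple p.
case: (tval p) sz_p wp Dp => [|e q] /= <-; first by rewrite (negPf xv).
case/andP=> /eqP <- wq /andP[De Dq]; exists e; split=> //.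
by rewrite ltnS; apply: hle.
Qed.

(** * Orders *)

Lemma sorted_infix2 (T : eqType) (e : rel T) s x y :
  sorted e s -> infix [:: x; y] s -> e x y.
Proof.
move=> es /infixP[s1 [s2 def_s]]; move: es; rewrite def_s.
by case/cat_sorted2=> _ /= /andP[].
Qed.

Lemma infix2_sorted (T : eqType) (s : seq T) :
  sorted [rel x y | infix [:: x; y] s] s.
Proof.
(* [x0] is kept as the default value of [nth]. *)
case: s => // x0 s; move: (x0 :: s) => {}s.
apply/(sortedP x0) => i lti; apply/infixP.
exists (take i s), (drop i.+2 s).
by rewrite /= -!drop_nth ?cat_take_drop // ltnW.
Qed.

(** Along a cycle, transitivity would put the first element below itself. *)
Lemma acyclic_of_order (T : eqType) (e lt : rel T) :
  transitive lt -> irreflexive lt -> subrel e lt -> acyclic e.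
Proof.
move=> tr irr sub [//|x c] /(sub_cycle sub) /= /(order_path_min tr).
by move/allP/(_ x); rewrite mem_rcons mem_head irr => /(_ isT).
Qed.

(** The rank counts ancestors: [y] is an ancestor of itself but not of [x], since that would close a
    cycle. *)
Lemma acyclic_rank (T : finType) (e : rel T) :
  acyclic e -> exists rk : T -> nat, forall x y, e x y -> rk x < rk y.
Proof.
move=> acy; exists (fun x => #|[set z | connect e z x]|) => x y exy.
apply/proper_card/properP; split.
  apply/subsetP=> z; rewrite !inE => zx.
  exact: connect_trans zx (connect1 exy).
exists y; rewrite inE ?connect0 //; apply/negP=> /connectP[p ep def_x].
suff /acy : cycle e (y :: p) by [].
by rewrite /= rcons_path ep -def_x.
Qed.

(** * Arborescences *)

Definition flip (A : Type) (x : A * bool) : A * bool := (x.1, ~~ x.2).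

Lemma unzip1_flip (A : Type) (p : seq (A * bool)) : unzip1 (map (@flip A) p) = unzip1 p.
Proof. by rewrite /unzip1 -map_comp. Qed.

Section Arborescence.
Variable G : multigraph.
Notation V := (vertex G).
Notation E := (edge G).

Lemma uwalk_rev (a b : V) p :
  walk (@usrc G) (@utgt G) a p b ->
  walk (@usrc G) (@utgt G) b (map (@flip E) (rev p)) a.
Proof.
move/walk_rev; rewrite -(walk_map (s := @usrc G) (t := @utgt G) (f := @flip E)) //.
all: by case=> e [].
Qed.

Lemma walk_dipath (T : {set E}) a p b :
  walk (@src G) (@tgt G) a p b -> all [in T] p ->
  exists p', dipath a p' b /\ {subset p' <= T}.
Proof.
move=> /walk_simple_path[q sub_q sq] /allP Tp.
by exists q; split=> // e /(mem_subseq sub_q); apply: Tp.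
Qed.

(** Go from [a] to [v], then traverse backwards the walk from [b] to [v]. *)
Lemma uconnected_to (T : {set E}) (v : V) :
  (forall x, exists2 p, walk (@src G) (@tgt G) x p v & all [in T] p) ->
  uconnected T.
Proof.
move=> wT a b.
have uw x : exists2 p, walk (@usrc G) (@utgt G) x p v & {subset unzip1 p <= T}.
  have [p wp /allP Tp] := wT x; pose p' := map (fun e => (e, true)) p.
  exists p'; first by rewrite (walk_map (s' := @src G) (t' := @tgt G)).
  by rewrite /unzip1 -map_comp map_id.
have [p wp Tp] := uw a; have [q wq Tq] := uw b.
have : walk (@usrc G) (@utgt G) a (p ++ map (@flip E) (rev q)) b.
  by apply/walk_cat; exists v => //; apply: uwalk_rev.
case/walk_simple_path=> c sub_c sc; exists c; split=> // e.
move/(mem_subseq (map_subseq _ sub_c)).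
rewrite map_cat mem_cat => /orP[/Tp //|].
by rewrite -/(unzip1 _) unzip1_flip /unzip1 map_rev mem_rev => /Tq.
Qed.

(* At a step of a closed walk where [h] turns from increasing to decreasing, the
   two edges have the same source, hence coincide. *)
Lemma uacyclic_descending (T : {set E}) (h : V -> nat) :
  {in T &, injective (@src G)} ->
  {in T, forall e, h (tgt e) < h (src e)} -> uacyclic T.
Proof.
move=> injT hT.
pose uw := walk (@usrc G) (@utgt G).
(* A walk whose first step is backward can never turn forward, so [h] rises all along it. *)
have up e q a b : uw a ((e, false) :: q) b ->
    {subset e :: unzip1 q <= T} -> uniq (e :: unzip1 q) -> h a < h b.
  elim: q e a => [|[e' d] q IHq] e a.
    rewrite /uw /= /usrc /utgt /= => /andP[/eqP <- /eqP <-] sT _.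
    by apply/hT/sT; rewrite inE.
  move=> /= /andP[/eqP <-] w sT u.
  have Te : e \in T by apply: sT; rewrite inE eqxx.
  have Te' : e' \in T by apply: sT; rewrite !inE eqxx orbT.
  case: d w => w.
    move: w u; rewrite /utgt /usrc /= => /andP[/eqP se _].
    by rewrite (injT _ _ Te' Te se) inE eqxx.
  apply: ltn_trans (hT _ Te) (IHq _ _ w _ _); last by case/andP: u.
  by move=> z zq; apply: sT; rewrite inE zq orbT.
have down e q a b : uw a (rcons q (e, true)) b ->
    {subset unzip1 (rcons q (e, true)) <= T} ->
    uniq (unzip1 (rcons q (e, true))) -> h b < h a.
  move=> /uwalk_rev; rewrite rev_rcons /= => w sT u.
  apply: up w _ _; rewrite unzip1_flip /unzip1 map_rev -rev_rcons -map_rcons.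
    by move=> z; rewrite mem_rev => /sT.
  by rewrite rev_uniq.
move=> a [//|[e1 d1] c] w sT u _.
(* By [up] and [down], a closed walk must start forward and end backward; both edges then have the
   base point as source, so they coincide, against uniqueness. *)
case: d1 w sT u => w sT u; last by have := up _ _ _ _ w sT u; rewrite ltnn.
case/lastP: c w sT u => [|c [e2 d2]] w sT u.
  by have := down e1 [::] _ _ w sT u; rewrite ltnn.
case: d2 w sT u => w sT u.
  by have := down e2 ((e1, true) :: c) _ _ w sT u; rewrite ltnn.
have e2c : e2 \in unzip1 (rcons c (e2, false)).
  by rewrite /unzip1 map_rcons mem_rcons mem_head.
have /uwalk_rev := w; rewrite -rcons_cons rev_rcons /= => /andP[/eqP sa2 _].
move: w => /= /andP[/eqP sa1 _].
have e12 : e1 = e2.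
  apply: injT; [by apply: sT; rewrite mem_head | | by rewrite [LHS]sa1 -sa2].
  by apply: sT; rewrite inE e2c orbT.
by move: u; rewrite /= e12 e2c.
Qed.

Lemma spanning_tree_into_exists (D : {set E}) (v : V) :
  (forall x, exists2 p, walk (@src G) (@tgt G) x p v & all [in D] p) ->
  exists2 T : {set E}, T \subset D & spanning_tree_into v T.
Proof.
move/walk_descends=> [h dD].
(* Choosing one decreasing edge per vertex makes [src] injective on [T], hence [T] acyclic, and
   still leaves a descent to [v]. *)
pose f x := [pick e in D | (src e == x) && (h (tgt e) < h x)].
pose T := [set e | f (src e) == Some e].
have TP e : e \in T -> (e \in D) && (h (tgt e) < h (src e)).
  rewrite inE /f; case: pickP => // e' /and3P[De' _ he'] /eqP[def_e].
  by rewrite def_e in De' he'; rewrite De'.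
have dT : descends (@src G) (@tgt G) [in T] v h.
  move=> x /dD[e [De se he]]; rewrite /= in De.
  case def_f: (f x) => [e'|].
    move: (def_f); rewrite /f; case: pickP => // e0 /and3P[De0 /eqP se0 he0] [e0e'].
    by rewrite e0e' in De0 se0 he0; exists e'; split=> //=; rewrite inE se0 def_f.
  by move: def_f; rewrite /f; case: pickP => // /(_ e); rewrite De se eqxx he.
have wT x : exists2 p, walk (@src G) (@tgt G) x p v & all [in T] p.
  have [p wp allp] := descends_walk dT x; exists p => //.
  by apply: sub_all allp => e /andP[].
exists T; first by apply/subsetP=> e /TP/andP[].
split; first split.
- exact: uconnected_to wT.
- apply: (@uacyclic_descending T h) => [e1 e2|e /TP/andP[] //].
  by rewrite !inE => /eqP f1 /eqP f2 s12; move: f2; rewrite -s12 f1 => -[].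
- by move=> x; have [p wp Tp] := wT x; apply: walk_dipath wp Tp.
Qed.

End Arborescence.

Definition reverse (G : multigraph) : multigraph := Multigraph (@tgt G) (@src G).

(** Reversing all edges amounts to flipping each undirected traversal, so the undirected conditions
    carry over. *)
Lemma spanning_tree_from_reverse (G : multigraph) (v : vertex G) (T : {set edge G}) :
  @spanning_tree_into (reverse G) v T -> spanning_tree_from v T.
Proof.
have swap_s : @usrc G \o @flip (edge G) =1 @usrc (reverse G) by case=> e [].
have swap_t : @utgt G \o @flip (edge G) =1 @utgt (reverse G) by case=> e [].
move=> [[conn acy] into]; split; first split.
- move=> a b; have [p [/andP[wp up] sT]] := conn a b.
  exists (map (@flip (edge G)) p); rewrite unzip1_flip; split=> //.
  rewrite /simple_path (walk_map _ _ _ swap_s swap_t) wp -map_comp.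
  by rewrite (eq_map swap_t).
- move=> a c; rewrite -[c](mapK (f := @flip _) (g := @flip _)); last first.
    by case=> e [].
  set c' := map _ c; rewrite (walk_map _ _ _ swap_s swap_t) unzip1_flip -map_comp.
  by rewrite (eq_map swap_t) => wc sT u1 u2; rewrite (acy a c').
- move=> u; have [p [/andP[wp _] sT]] := into u.
  apply: walk_dipath (walk_rev wp) _.
  by apply/allP=> e; rewrite mem_rev => /sT.
Qed.

Lemma spanning_tree_from_exists (G : multigraph) (D : {set edge G}) (v : vertex G) :
  (forall x, exists2 p, walk (@src G) (@tgt G) v p x & all [in D] p) ->
  exists2 T : {set edge G}, T \subset D & spanning_tree_from v T.
Proof.
move=> wD; have [x|T TD] := @spanning_tree_into_exists (reverse G) D v.
  by have [p /walk_rev wp Dp] := wD x; exists (rev p); rewrite ?all_rev.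
by exists T => //; apply: spanning_tree_from_reverse.
Qed.

(** * From trees to routings *)

Lemma routing_of_trees (G : multigraph) (v : vertex G) (Tin Tout : {set edge G}) :
  [disjoint Tin & Tout] -> spanning_tree_into v Tin -> spanning_tree_from v Tout ->
  exists r : vertex G -> vertex G -> seq (edge G), is_routing r /\ deadlock_free r.
Proof.
move=> dis [_ into] [_ from].
have [h1 d1] : exists h, descends (@src G) (@tgt G) [in Tin] v h.
  apply: walk_descends => x; have [p [/andP[wp _] Tp]] := into x.
  by exists p => //; apply/allP.
have [h2 d2] : exists h, descends (@tgt G) (@src G) [in Tout] v h.
  apply: walk_descends => x; have [p [/andP[wp _] Tp]] := from x.
  exists (rev p); first exact: walk_rev.
  by rewrite all_rev; apply/allP.
(* [Tin] comes first, ordered by decreasing [h1] of the source; the other edges follow, by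
   increasing [h2] of the target. *)
pose lt := [rel e1 e2 | if e1 \in Tin then (e2 \in Tin) ==> (h1 (src e2) < h1 (src e1))
                        else (e2 \notin Tin) && (h2 (tgt e1) < h2 (tgt e2))].
have lt_tr : transitive lt.
  move=> y x z /=; case: (x \in Tin); case: (y \in Tin); case: (z \in Tin) => //=.
    by move=> hxy hyz; apply: ltn_trans hyz hxy.
  exact: ltn_trans.
have lt_irr : irreflexive lt by move=> x /=; case: (x \in Tin); rewrite /= ltnn.
have ex_route a b : exists q, dipath a q b && sorted lt q.
  have [p wp allp] := descends_walk d1 a.
  have [p' wp' allp'] := descends_walk d2 b.
  have outP e : e \in Tout -> e \notin Tin by move=> Te; rewrite (disjointFl dis Te).
  have sp : sorted lt p.
    apply: walk_sorted wp allp => e1 e2 /andP[/= T1 lt1] /andP[/= T2 _] e12 /=.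
    by rewrite T1 T2 -e12.
  have wq := walk_rev wp'; rewrite -all_rev in allp'.
  have sq : sorted lt (rev p').
    apply: walk_sorted wq allp' => e1 e2 /andP[/= T1 _] /andP[/= T2 lt2] e12 /=.
    by rewrite (negPf (outP _ T1)) (outP _ T2) e12.
  (* Transitivity turns sortedness into a pairwise condition, so only pairs from [Tin] and [Tout]
     remain to compare. *)
  have spq : sorted lt (p ++ rev p').
    rewrite sorted_pairwise // pairwise_cat -!sorted_pairwise // sp sq !andbT.
    apply/allrelP=> e1 e2 /(allP allp)/andP[/= T1 _] /(allP allp')/andP[/= T2 _].
    by rewrite T1 (negPf (outP _ T2)).
  have /walk_simple_path[c sub_c sc] : walk (@src G) (@tgt G) a (p ++ rev p') b.
    by apply/walk_cat; exists v.
  by exists c; rewrite /dipath sc (subseq_sorted lt_tr sub_c spq).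
pose r a b := xchoose (ex_route a b).
have rP a b : dipath a (r a b) b && sorted lt (r a b).
  exact: (xchooseP (ex_route a b)).
exists r; split=> [a b _|]; first by case/andP: (rP a b).
apply: (acyclic_of_order lt_tr lt_irr) => e1 e2 /existsP[a /existsP[b /andP[_]]].
by apply: sorted_infix2; case/andP: (rP a b).
Qed.

(** * From routings to trees *)

Section TreesOfRouting.
Variable G : multigraph.
Notation V := (vertex G).
Notation E := (edge G).

Definition arc (D : {set E}) : rel V :=
  [rel x y | [exists e in D, (src e == x) && (tgt e == y)]].

Lemma arcI (D : {set E}) e : e \in D -> arc D (src e) (tgt e).
Proof. by move=> De; apply/existsP; exists e; rewrite De !eqxx. Qed.

Lemma connect_arcP (D : {set E}) x y :
  reflect (exists2 p, walk (@src G) (@tgt G) x p y & all [in D] p) (connect (arc D) x y).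
Proof.
apply: (iffP idP) => [/connectP[p]|[p]].
  elim: p x => [|z p IHp] x /=; first by move=> _ ->; exists [::]; rewrite /= ?eqxx.
  case/andP=> /existsP[e /and3P[De /eqP <- /eqP <-]] pp def_y.
  have [q wq Dq] := IHp _ pp def_y.
  by exists (e :: q); rewrite /= ?eqxx ?wq ?De.
elim: p x => [|e p IHp] x /=; first by move=> /eqP->.
case/andP=> /eqP <- wp /andP[De Dp].
exact: connect_trans (connect1 (arcI De)) (IHp _ wp Dp).
Qed.

(** Stop the walk at the first use of [g]: what precedes avoids [g] and ends at its source. *)
Lemma connect_arcD1 (D : {set E}) g x y :
  connect (arc D) x y ->
  connect (arc (D :\ g)) x y \/ connect (arc (D :\ g)) x (src g).
Proof.
case/connectP=> p; elim: p x => [|z p IHp] x /=; first by move=> _ ->; left.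
case/andP=> /existsP[e /and3P[De /eqP <- /eqP <-]] pp def_y.
have [->|eg] := eqVneq e g; first by right.
have e1 : connect (arc (D :\ g)) (src e) (tgt e).
  by apply/connect1/arcI; rewrite !inE eg.
by have [c|c] := IHp _ pp def_y; [left | right]; apply: connect_trans e1 c.
Qed.

Definition in_closed (dep : rel E) (D : {set E}) : bool :=
  [forall e1, forall e2, dep e1 e2 && (e2 \in D) ==> (e1 \in D)].

Lemma in_closedP (dep : rel E) (D : {set E}) :
  reflect (forall e1 e2, dep e1 e2 -> e2 \in D -> e1 \in D) (in_closed dep D).
Proof.
apply: (iffP idP) => [cD e1 e2 d12 D2|cD].
  by have /forallP/(_ e1)/forallP/(_ e2) := cD; rewrite d12 D2.
by apply/forallP=> e1; apply/forallP=> e2; apply/implyP=> /andP[]; apply: cD.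
Qed.

Definition absorbing (D : {set E}) (v : V) : bool := [forall x, connect (arc D) x v].

Lemma minimal_in_closed_sink (dep : rel E) :
  acyclic dep -> (forall e1 e2, dep e1 e2 -> tgt e1 = src e2) ->
  (exists v, absorbing setT v) ->
  exists D v, [/\ in_closed dep D, absorbing D v & {in D, forall f, src f != v}].
Proof.
move=> /acyclic_rank[rk rkP] depP [v0 abs0].
pose P D := in_closed dep D && [exists v, absorbing D v].
have PT : P setT by apply/andP; split; [apply/in_closedP | apply/existsP; exists v0].
case: (arg_minnP (fun D : {set E} => #|D|) PT) => D /andP[cD /existsP[v absD]] minD.
exists D, v; split=> // f Df; apply/eqP=> sf.
pose M := [pred e | (e \in D) && connect dep f e].
have fM : M f by rewrite /= Df connect0.
case: (arg_maxnP rk fM) => g /andP[Dg fg] maxg.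
have Pg : P (D :\ g).
  apply/andP; split.
    (* An edge of [D] depending on [g] would lie in [M] with a larger rank. *)
    apply/in_closedP=> e1 e2 d12; rewrite !inE => /andP[_ D2].
    have D1 := in_closedP _ _ cD _ _ d12 D2; rewrite D1 andbT.
    apply/eqP=> e1g; rewrite e1g in d12.
    suff /maxg : M e2 by apply/negP; rewrite -ltnNge; apply: rkP.
    by rewrite /= D2 (connect_trans fg (connect1 d12)).
  (* Consecutive dependencies share a vertex, so the chain from [f] to [g] is a walk; its edges
     before [g] have smaller rank, hence differ from [g]. *)
  have vg : connect (arc (D :\ g)) v (src g).
    rewrite -sf; case/connectP: fg => p; elim: p f {Df sf M fM maxg} => [|e p IHp] f /=.
      by move=> _ ->.
    case/andP=> dfe pp def_g.
    have [eD rk_e] : e \in D /\ rk e <= rk g.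
      move: pp def_g; elim: p e {IHp dfe} => [|e' p IHp] e /=; first by move=> _ <-.
      case/andP=> dee' pp /(IHp _ pp)[De' rke']; split.
        exact: (in_closedP _ _ cD) dee' De'.
      exact: ltnW (leq_trans (rkP _ _ dee') rke').
    apply: connect_trans (IHp e pp def_g); rewrite -(depP _ _ dfe).
    apply/connect1/arcI; rewrite !inE (in_closedP _ _ cD _ _ dfe eD) andbT.
    by apply/eqP=> fg; have := leq_trans (rkP _ _ dfe) rk_e; rewrite fg ltnn.
  (* The source of [g] is the new absorbing vertex, reached directly or through [v]. *)
  apply/existsP; exists (src g); apply/forallP=> x.
  have [c|//] := connect_arcD1 g (forallP absD x).
  exact: connect_trans c vg.
by have := minD _ Pg; rewrite [#|D|](cardsD1 g) Dg ltnn.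
Qed.

Lemma trees_of_routing (r : V -> V -> seq E) :
  strongly_connected G -> is_routing r -> deadlock_free r ->
  exists (v : V) (Tin Tout : {set E}),
    [/\ [disjoint Tin & Tout], spanning_tree_into v Tin & spanning_tree_from v Tout].
Proof.
move=> [/card_gt0P[v0 _] sc] rP acy.
have depP e1 e2 : dependency r e1 e2 -> tgt e1 = src e2.
  case/existsP=> a /existsP[b /andP[ab]].
  by case/andP: (rP a b ab) => wr _; apply: walk_infix2 wr.
have abs0 : exists v, absorbing [set: E] v.
  exists v0; apply/forallP=> x; apply/connect_arcP.
  have [p /andP[wp _]] := sc x v0.
  by exists p => //; apply/allP=> e; rewrite inE.
have [D [v [cD absD noexit]]] := minimal_in_closed_sink acy depP abs0.
have wout x : exists2 p, walk (@src G) (@tgt G) v p x & all [in ~: D] p.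
  have [->|xv] := eqVneq x v; first by exists [::]; rewrite /= ?eqxx.
  rewrite eq_sym in xv; have /andP[wr _] := rP v x xv.
  exists (r v x) => //.
  have : sorted (dependency r) (r v x).
    apply: sub_sorted (infix2_sorted (r v x)) => e1 e2 /= inf.
    by apply/existsP; exists v; apply/existsP; exists x; rewrite xv.
  (* Closure of [D] under predecessors means closure of its complement under successors, so a route
     that starts outside [D] never enters it. *)
  have stepC e1 e2 : dependency r e1 e2 -> e1 \in ~: D -> e2 \in ~: D.
    by rewrite !inE => d12; apply: contra; apply: (in_closedP _ _ cD).
  case: (r v x) wr => //= e p /andP[/eqP se _].
  have : e \in ~: D by rewrite inE; apply/negP=> /noexit; rewrite se eqxx.
  elim: p e {se} => [|e' p IHp] e De /=; first by rewrite De.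
  by case/andP=> dee' pp; rewrite De (IHp e') // (stepC e e').
have [Tin TinD tin] : exists2 T : {set E}, T \subset D & spanning_tree_into v T.
  by apply: spanning_tree_into_exists => x; apply/connect_arcP/(forallP absD).
have [Tout ToutD tout] := spanning_tree_from_exists wout.
exists v, Tin, Tout; split=> //.
by apply: disjointWl TinD _; rewrite disjoint_sym disjoints_subset.
Qed.

End TreesOfRouting.

Theorem theorem1 (G : multigraph) (hG : strongly_connected G) :
  (exists r : vertex G -> vertex G -> seq (edge G),
      is_routing r /\ deadlock_free r) <->
  (exists (v : vertex G) (Tin Tout : {set edge G}),
      [/\ [disjoint Tin & Tout],
          spanning_tree_into v Tin
        & spanning_tree_from v Tout]).
Proof.
split=> [[r [rP dfr]]|[v [Tin [Tout [dis tin tout]]]]].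
  exact: trees_of_routing hG rP dfr.
exact: routing_of_trees dis tin tout.
Qed.
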